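(* Let $\underline{\lambda}=(\lambda_1^{\rho_1}>\lambda_2^{\rho_2}>\cdots>\lambda_k^{\rho_k})$ be a partition and set $\lambda_{k+1}=0$. Let $p$ be an odd prime, let $\mathcal{A}_{\underline{\lambda}}=\bigoplus_{i=1}^k(\mathbb{Z}/p^{\lambda_i}\mathbb{Z})^{\rho_i}$ and let $\mathcal{G}_{\underline{\lambda}}=\operatorname{Aut}(\mathcal{A}_{\underline{\lambda}})$. Then, for the trivial action of $\mathcal{G}_{\underline{\lambda}}$ on $\mathcal{A}_{\underline{\lambda}}$, $H^1(\mathcal{G}_{\underline{\lambda}},\mathcal{A}_{\underline{\lambda}})=0$ if and only if $\lambda_i-\lambda_{i+1}\leq 1$ for all $1\leq i\leq k$.
   Context: A partition $\underline{\lambda}=(\lambda_1^{\rho_1}>\cdots>\lambda_k^{\rho_k})$ consists of positive integers $\lambda_1>\lambda_2>\cdots>\lambda_k$ (the distinct parts) with positive integer multiplicities $\rho_1,\dots,\rho_k$, $k\geq 1$. $H^i$ denotes ordinary group cohomology. *)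

(* Defs.v *)
From HB Require Import structures.
From mathcomp Require Import all_boot all_order all_fingroup all_algebra.

Set Implicit Arguments.
Unset Strict Implicit.
Unset Printing Implicit Defensive.

Import GRing.Theory.
Local Open Scope ring_scope.

(* The direct sum of a finite family of finite abelian groups; dependent      *)
(* finite functions carry no additive structure in the library.               *)
Section DirectSum.

Variables (I : finType) (V : I -> finZmodType).

Definition dsum := {dffun forall i : I, V i}.

HB.instance Definition _ := Finite.on dsum.

Implicit Types x y z : dsum.

Definition dsum_zero : dsum := [ffun i => 0].
Definition dsum_opp x : dsum := [ffun i => - x i].
Definition dsum_add x y : dsum := [ffun i => x i + y i].

Fact dsum_addA : associative dsum_add.
Proof. by move=> x y z; apply/ffunP=> i; rewrite !ffunE addrA. Qed.

Fact dsum_addC : commutative dsum_add.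
Proof. by move=> x y; apply/ffunP=> i; rewrite !ffunE addrC. Qed.

Fact dsum_add0 : left_id dsum_zero dsum_add.
Proof. by move=> x; apply/ffunP=> i; rewrite !ffunE add0r. Qed.

Fact dsum_addN : left_inverse dsum_zero dsum_opp dsum_add.
Proof. by move=> x; apply/ffunP=> i; rewrite !ffunE addNr. Qed.

HB.instance Definition _ :=
  GRing.isZmodule.Build dsum dsum_addA dsum_addC dsum_add0 dsum_addN.
HB.instance Definition _ := [finGroupMixin of dsum for +%R].

End DirectSum.

(* Left actions of gT on the abelian group M by group endomorphisms, i.e.     *)
(* structures of Z[gT]-module on M.                                           *)
Record gmodule (gT : finGroupType) (M : finZmodType) := GModule {
  gact :> gT -> {additive M -> M};
  gact1 : forall m, gact 1%g m = m;
  gactM : forall g h m, gact (g * h)%g m = gact g (gact h m)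
}.

Section TrivialModule.

Variables (gT : finGroupType) (M : finZmodType).

Let triv_act (g : gT) : {additive M -> M} := idfun.

Definition trivial_gmodule : gmodule gT M :=
  @GModule gT M triv_act (fun=> erefl) (fun _ _ _ => erefl).

End TrivialModule.

(* Group cohomology, by the inhomogeneous (bar) cochain complex.             *)
Section Cohomology.

Variables (gT : finGroupType) (M : finZmodType).

Definition cochain n := {ffun n.-tuple gT -> M}.

HB.instance Definition _ n := Finite.on (cochain n).
HB.instance Definition _ n := GRing.Zmodule.on (cochain n).
HB.instance Definition _ n := [finGroupMixin of cochain n for +%R].

(* With x = (x_0, ..., x_n): face 0 drops x_0, face n.+1 drops x_n, and       *)
(* for 0 < i <= n, face i replaces x_(i - 1), x_i by their product.           *)
Definition face n (i : nat) (x : n.+1.-tuple gT) : n.-tuple gT :=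
  [tuple (if (j.+1 < i)%N then nth 1 x j
          else if j.+1 == i then nth 1 x j * nth 1 x j.+1
          else nth 1 x j.+1)%g | j < n].

Variable act : gmodule gT M.

Definition coboundary_map n (f : cochain n) : cochain n.+1 :=
  [ffun x => act (thead x) (f (face 0 x))
             + \sum_(1 <= i < n.+2) f (face i x) *~ (-1) ^+ i].

Fact coboundary_map_is_additive n : zmod_morphism (@coboundary_map n).
Proof.
move=> f g; apply/ffunP=> x; rewrite !ffunE raddfB opprD addrACA -sumrB.
by congr (_ + _); apply: eq_bigr => i _; rewrite !ffunE mulrzBl.
Qed.

HB.instance Definition _ n :=
  GRing.isZmodMorphism.Build (cochain n) (cochain n.+1) (@coboundary_map n)
    (@coboundary_map_is_additive n).

Definition cocycles n : {set cochain n} :=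
  [set f | coboundary_map f == 0].

Definition coboundaries n : {set cochain n} :=
  if n is m.+1 then [set coboundary_map f | f : cochain m] else [set 0].

Fact cocycles_group_set n : group_set (cocycles n).
Proof.
apply/group_setP; split=> [|f g]; rewrite !inE; first by rewrite raddf0.
by move=> /eqP f0 /eqP g0; rewrite FinRing.zmodMgE raddfD /= f0 g0 addr0.
Qed.
Canonical cocycles_group n := Group (@cocycles_group_set n).

Fact coboundaries_group_set n : group_set (coboundaries n).
Proof.
case: n => [|n]; apply/group_setP; split; rewrite ?inE //=.
- by move=> f g; rewrite !inE => /eqP-> /eqP->; rewrite FinRing.zmodMgE addr0.
- by apply/imsetP; exists 0; rewrite ?inE ?raddf0.
- move=> _ _ /imsetP[f _ ->] /imsetP[g _ ->]; apply/imsetP.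
  by exists (f + g); rewrite ?inE ?raddfD.
Qed.
Canonical coboundaries_group n := Group (@coboundaries_group_set n).

Definition cohomology n := (cocycles n / coboundaries n)%g.
Canonical cohomology_group n := [group of cohomology n].

Definition coface n (i : nat) (f : cochain n) : cochain n.+1 :=
  [ffun x => if i == 0%N then act (thead x) (f (face 0 x))
             else f (face i x)].

Fact coboundary_mapE n (f : cochain n) :
  coboundary_map f = \sum_(i < n.+2) coface i f *~ (-1) ^+ i.
Proof.
apply/ffunP=> x; rewrite ffunE sum_ffunE big_ord_recl /= expr0 mulr1z ffunE /=.
congr (_ + _); rewrite big_add1 /= big_mkord; apply: eq_bigr => i _.
have mulz_ffun (h : cochain n.+1) m : (h *~ m) x = h x *~ m.
  by case: m => m; rewrite ?NegzE ?mulrNz ?ffunE -!pmulrn ?ffunMnE.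
by rewrite mulz_ffun ffunE.
Qed.

Fact nth_face n i (x : n.+1.-tuple gT) k : (k < n)%N ->
  nth 1%g (face i x) k =
    (if (k.+1 < i)%N then nth 1 x k
     else if k.+1 == i then nth 1 x k * nth 1 x k.+1
     else nth 1 x k.+1)%g.
Proof.
by move=> kn; rewrite -[k]/(val (Ordinal kn)) -tnth_nth tnth_mktuple.
Qed.

Fact face_face n i j (x : n.+2.-tuple gT) :
  (j <= i)%N -> face i (face j x) = face j (face i.+1 x).
Proof.
move=> le_ji; apply: eq_from_tnth => k; rewrite !(tnth_nth 1%g).
have kn := ltn_ord k; have kn1 : (k < n.+1)%N by exact: leqW.
rewrite !nth_face // !ltnS !eqSS.
move: (nth _ x) (val k) le_ji => c m; clear => le_ji.
have [lt_mj|le_jm] := ltnP m.+1 j.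
  by rewrite (leq_trans lt_mj le_ji) (ltnW (leq_trans lt_mj le_ji)).
have -> : (m.+2 < j)%N = false by apply/negbTE; rewrite -leqNgt leqW.
have -> : (m.+2 == j) = false by rewrite gtn_eqF.
case: eqP => [eq_mj|_].
  have lt_mi : (m < i)%N by rewrite eq_mj.
  by rewrite lt_mi; case: (ltngtP m.+1 i) lt_mi => //; rewrite ?mulgA.
by [].
Qed.

Fact thead_face n i (x : n.+2.-tuple gT) :
  thead (face i x) = (if (1 < i)%N then thead x
                      else if i == 1%N then thead x * nth 1 x 1
                      else nth 1 x 1)%g.
Proof. by rewrite /thead !(tnth_nth 1%g) nth_face //= eq_sym. Qed.

Fact coface_coface n i j (f : cochain n) :
  (j <= i)%N -> coface j (coface i f) = coface i.+1 (coface j f).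
Proof.
move=> le_ji; apply/ffunP=> x; rewrite !ffunE /= !thead_face.
case: j i le_ji => [|j] [|i] //= le_ji.
- by rewrite face_face // gactM /thead (tnth_nth 1%g).
- by rewrite face_face.
- by rewrite face_face.
Qed.

Fact coface_is_additive n i : zmod_morphism (@coface n i).
Proof.
by move=> f g; apply/ffunP=> x; rewrite !ffunE; case: ifP; rewrite ?raddfB.
Qed.

HB.instance Definition _ n i :=
  GRing.isZmodMorphism.Build (cochain n) (cochain n.+1) (@coface n i)
    (@coface_is_additive n i).

Fact coboundary_mapK n (f : cochain n) :
  coboundary_map (coboundary_map f) = 0.
Proof.
rewrite !coboundary_mapE.
under eq_bigr => j _ do rewrite raddf_sum /= mulrz_suml.
rewrite pair_big /=.
rewrite (bigID (fun u : 'I_n.+3 * 'I_n.+2 => (u.1 <= u.2)%N)) /=.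
apply/eqP; rewrite addr_eq0 -sumrN; apply/eqP.
pose h (u : 'I_n.+3 * 'I_n.+2) : 'I_n.+3 * 'I_n.+2 :=
  (lift ord0 u.2, inord u.1).
pose h' (u : 'I_n.+3 * 'I_n.+2) : 'I_n.+3 * 'I_n.+2 :=
  (widen_ord (leqnSn _) u.2, inord u.1.-1).
rewrite (reindex_onto h' h) /=; last first.
  move=> [j i] /= le_ji; rewrite /h' /h /=; congr (_, _); apply: val_inj => //=.
    by rewrite inordK // (leq_ltn_trans le_ji).
  by rewrite inord_val.
have condE (u : 'I_n.+3 * 'I_n.+2) :
  (u.2 <= (inord u.1.-1 : 'I_n.+2))%N && (h (h' u) == u) = ~~ (u.1 <= u.2)%N.
  case: u => [[[|j] lt_j] i] /=.
    by apply/negP=> /andP[_ /eqP[]].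
  rewrite inordK // -ltnNge ltnS; case: leqP => //= le_ij.
  apply/eqP; congr (_, _); first by apply: val_inj; rewrite /= inordK.
  by apply: val_inj; rewrite /= inordK.
apply: eq_big => [u|[[[|j] lt_j] i]] /=; first exact: condE.
  by rewrite (condE (Ordinal lt_j, i)).
rewrite inordK // => /andP[le_ij _].
rewrite !raddfMz /= coface_coface // exprS mulN1r mulrNz mulNrz mulNrz opprK.
by rewrite -!mulrzA mulrC.
Qed.

Fact coboundaries_sub n : coboundaries n.+1 \subset cocycles n.+1.
Proof.
by apply/subsetP=> _ /imsetP[f _ ->]; rewrite inE coboundary_mapK.
Qed.

End Cohomology.

Arguments cohomology {gT M} act n.

Definition next_part k (lam : 'I_k -> nat) (i : 'I_k) : nat :=
  if insub i.+1 is Some j then lam j else 0%N.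

(* 'Z_m is Z/mZ only for m > 1, which holds here as soon as p is prime and    *)
(* the parts lam i are positive.                                              *)
Definition abelian_pgroup p k (lam rho : 'I_k -> nat) : finZmodType :=
  dsum (fun i => 'rV['Z_(p ^ lam i)]_(rho i)).

(* In {perm A}, s * t means "s, then t", so this is the opposite of Aut(A)    *)
(* under composition; inversion identifies the two.                           *)
Definition automorphism_group (A : finZmodType) : finGroupType :=
  [subg Aut [set: A]].

(* Main.v *)
(* The action being trivial, H^1(G, A) = Hom(G, A).                           *)
(*   If all gaps are at most 1, such a homomorphism kills transvections       *)
(* (conjugation by a reflection inverts them and p is odd), hence dilations:  *)
(* for a basis vector of order p^(n+1), the (p-1)-st power of a dilation is   *)
(* congruent modulo transvections to a dilation of a vector of order p^n, and *)
(* is trivial if n = 0. These generate G by Gaussian elimination.             *)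
(*   If lambda_i - lambda_(i+1) >= 2, put m = lambda_(i+1): the quotient      *)
(* p^m A / p^(m+2) A is free over Z/p^2, and the Fermat quotient of the       *)
(* determinant of the action of G on it is a nonzero homomorphism to Z/p.     *)
Require Import Defs.
From mathcomp Require Import all_boot all_order all_fingroup all_algebra.
From mathcomp Require Import cyclic ring.

Set Implicit Arguments.
Unset Strict Implicit.
Unset Printing Implicit Defensive.

Import GRing.Theory.
Local Open Scope ring_scope.

(** By [aut_H1_trivialP] the question is whether every homomorphism from the automorphism group to
    [A] vanishes; this is studied through a basis [e] whose coordinates [co] count modulo [p ^ l b].
    Small gaps: [aut_killed] reduces an automorphism to ones moving a single basis vector, and
    [elem_killed] splits each of these into a transvection and a dilation. A transvection is
    conjugate to its inverse ([transvection_killed]). A dilation of [e b] is traded for one of a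
    vector whose exponent is one less ([dilation_killed]); the gap condition supplies that vector
    until the exponent reaches 1. Large gap: when no exponent equals [m.+1], the matrix of an
    automorphism on the vectors of exponent at least [m.+2] is multiplicative modulo [p ^ 2]
    ([gap_mxM]). The Fermat quotient turns its determinant into an additive invariant modulo [p],
    nonzero on a dilation by [1 + p] ([nontrivial_hom]). *)

Section ZmodAut.

(** * Additive automorphisms as permutations *)

Variable A : finZmodType.
Implicit Types (s t : {perm A}) (a : A).

Lemma zmod_autD s : s \in Aut [set: A] -> {morph s : a a' / a + a'}.
Proof.
move=> /Aut_morphic/morphicP sM a a'.
by rewrite -!FinRing.zmodMgE sM ?inE.
Qed.

Lemma zmod_aut0 s : s \in Aut [set: A] -> s 0 = 0.
Proof.
by move=> /zmod_autD sD; apply: (@addIr _ (s 0)); rewrite -sD !add0r.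
Qed.

Lemma zmod_autMn s n : s \in Aut [set: A] -> {morph s : a / a *+ n}.
Proof.
move=> sA a; elim: n => [|n IHn]; first exact: zmod_aut0.
by rewrite !mulrSr zmod_autD ?IHn.
Qed.

Lemma zmod_aut_sum s I (r : seq I) (P : pred I) (F : I -> A) :
  s \in Aut [set: A] -> s (\sum_(i <- r | P i) F i) = \sum_(i <- r | P i) s (F i).
Proof. by move=> sA; apply: big_morph; [exact: zmod_autD|exact: zmod_aut0]. Qed.

(** A trivial kernel suffices because [A] is finite: an injective self-map is a permutation. *)
Lemma zmod_aut_exists (g : A -> A) :
  {morph g : a a' / a + a'} -> (forall a, g a = 0 -> a = 0) ->
  exists2 s, s \in Aut [set: A] & forall a, s a = g a.
Proof.
move=> gD g0.
have g00 : g 0 = 0 by apply: (@addIr _ (g 0)); rewrite -gD !add0r.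
have g_inj : injective g.
  move=> a a' gaa'; apply/eqP; rewrite -subr_eq0; apply/eqP/g0.
  by apply: (@addIr _ (g a')); rewrite -gD subrK add0r.
exists (perm g_inj) => [|a]; last by rewrite permE.
rewrite inE; apply/andP; split; first by apply/subsetP=> a _; rewrite inE.
by apply/morphicP=> a a' _ _; rewrite !FinRing.zmodMgE !permE gD.
Qed.

End ZmodAut.

Lemma mulrn_modn (M : zmodType) (a : M) d m n :
  a *+ d = 0 -> m = n %[mod d] -> a *+ m = a *+ n.
Proof.
move=> ad mn; rewrite (divn_eq m d) (divn_eq n d) mn.
by rewrite !mulrnDr !(mulnC _ d) !mulrnA ad !mul0rn !add0r.
Qed.

(** * Fermat quotients as a logarithm modulo [p] *)

Section FermatQuotient.

Variable p : nat.
Hypothesis p_pr : prime p.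

(** For [u] prime to [p] this is the classical [(u ^ (p - 1) - 1) / p]: the floor absorbs the 1. *)
Definition fermat_quotient u := (u ^ p.-1 %/ p)%N.

Lemma expn_fermat u : coprime p u -> (u ^ p.-1 = 1 + p * fermat_quotient u)%N.
Proof.
move=> pu; rewrite {1}(divn_eq (u ^ p.-1) p) addnC mulnC; congr (_ + _)%N.
rewrite -totient_prime // Euler_exp_totient 1?coprime_sym //.
by rewrite modn_small ?prime_gt1.
Qed.

Let modn_pp_cancel x y :
  (1 + p * x = 1 + p * y %[mod p ^ 2])%N -> (x = y %[mod p])%N.
Proof.
move/eqP; rewrite eqn_modDl -mulnn -!muln_modr.
by rewrite eqn_pmul2l ?prime_gt0 // => /eqP.
Qed.

(** [(1 + p x) (1 + p y)] is [1 + p (x + y)] modulo [p ^ 2]. The argument [u] is separate from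
    [v * w] because determinants will be known only modulo [p ^ 2]. *)
Lemma fermat_quotientM u v w :
  coprime p v -> coprime p w -> (u = v * w %[mod p ^ 2])%N ->
  (fermat_quotient u = fermat_quotient v + fermat_quotient w %[mod p])%N.
Proof.
move=> pv pw uvw.
have pu : coprime p u.
  rewrite -(coprime_pexpl p u (isT : 0 < 2)%N) -coprime_modr uvw coprime_modr.
  by rewrite coprimeXl // coprimeMr pv.
have := modnXm p.-1 (p ^ 2) u; rewrite uvw modnXm expnMn => /esym.
rewrite !expn_fermat //; set x := fermat_quotient v; set y := fermat_quotient w.
have -> : ((1 + p * x) * (1 + p * y) = x * y * p ^ 2 + (1 + p * (x + y)))%N by ring.
by rewrite modnMDl => /modn_pp_cancel.
Qed.

Lemma fermat_quotient_succ u :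
  (u = 1 + p %[mod p ^ 2])%N -> (fermat_quotient u = p.-1 %[mod p])%N.
Proof.
move=> u1.
have pu : coprime p u.
  rewrite -(coprime_pexpl p u (isT : 0 < 2)%N) -coprime_modr u1 coprime_modr.
  by rewrite coprimeXl // add1n coprimenS.
apply: modn_pp_cancel; rewrite -expn_fermat // -modnXm u1 modnXm.
elim: p.-1 => [|n IHn]; first by rewrite expn0 muln0.
rewrite expnS -modnMmr IHn modnMmr.
have -> : ((1 + p) * (1 + p * n) = n * p ^ 2 + (1 + p * n.+1))%N by ring.
by rewrite modnMDl.
Qed.

End FermatQuotient.

(** * Bases and automorphisms moving a single basis vector *)

Section Coordinates.

Variables (A : finZmodType) (B : finType) (p : nat) (l : B -> nat).
(* The coordinates [co a b] are only meaningful modulo [p ^ l b].            *)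
Variables (e : B -> A) (co : A -> B -> nat).

Hypothesis p_pr : prime p.
Hypothesis l_gt0 : forall b, (0 < l b)%N.
Hypothesis co_sum : forall a, a = \sum_b e b *+ co a b.
Hypothesis coD : forall a a' b, co (a + a') b = (co a b + co a' b)%N %[mod p ^ l b].
Hypothesis co_e : forall b c, co (e b) c = (b == c) %[mod p ^ l c].
Hypothesis e_ord : forall b, e b *+ p ^ l b = 0.

Lemma co0 b : co 0 b = 0 %[mod p ^ l b].
Proof.
apply/eqP; rewrite -(eqn_modDl (co 0 b)) addn0 -coD addr0; exact/eqP.
Qed.

Lemma coMn a n b : co (a *+ n) b = (co a b * n)%N %[mod p ^ l b].
Proof.
elim: n => [|n IHn]; first by rewrite mulr0n muln0 co0.
by rewrite mulrS coD mulnS -modnDmr IHn modnDmr.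
Qed.

Lemma co_bigsum I (r : seq I) (P : pred I) (F : I -> A) b :
  co (\sum_(i <- r | P i) F i) b = (\sum_(i <- r | P i) co (F i) b)%N %[mod p ^ l b].
Proof.
elim/big_rec2: _ => [|i n a _ IH]; first exact: co0.
by rewrite coD -modnDmr IH modnDmr.
Qed.

Lemma co_e_neq b c : c != b -> co (e c) b = 0 %[mod p ^ l b].
Proof. by move=> cb; rewrite co_e (negbTE cb). Qed.

Lemma co_e_eq b : co (e b) b = 1 %[mod p ^ l b].
Proof. by rewrite co_e eqxx. Qed.

Definition elementary b (w : A) (s : {perm A}) :=
  [/\ s \in Aut [set: A], s (e b) = w & forall c, c != b -> s (e c) = e c].

Lemma aut_co s a : s \in Aut [set: A] -> s a = \sum_c s (e c) *+ co a c.
Proof.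
move=> sA; rewrite {1}[a]co_sum zmod_aut_sum //.
by apply: eq_bigr => c _; rewrite zmod_autMn.
Qed.

Lemma aut_eq s t : s \in Aut [set: A] -> t \in Aut [set: A] ->
  (forall b, s (e b) = t (e b)) -> s = t.
Proof.
move=> sA tA st; apply/permP=> a; rewrite !aut_co //.
by apply: eq_bigr => c _; rewrite st.
Qed.

Lemma elemE b w s a : elementary b w s -> s a = a + (w - e b) *+ co a b.
Proof.
case=> sA sb sc; rewrite aut_co // [X in _ = X + _](co_sum a) (bigD1 b) //=.
rewrite [in RHS](bigD1 b) //= sb [RHS]addrAC. rewrite -mulrnDl subrKC.
by congr (_ + _); apply: eq_bigr => c /sc->.
Qed.

Lemma elem_fix b w s a : elementary b w s -> co a b = 0 %[mod p ^ l b] -> s a = a.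
Proof.
move=> sbw a0; have [sA sb _] := sbw.
rewrite (elemE _ sbw) -[RHS]addr0; congr (_ + _).
apply: (mulrn_modn _ a0); rewrite mulrnBl e_ord subr0 -sb -zmod_autMn // e_ord.
exact: zmod_aut0.
Qed.

Lemma elem_ord b w s : elementary b w s -> w *+ p ^ l b = 0.
Proof. by case=> sA <- _; rewrite -zmod_autMn // e_ord zmod_aut0. Qed.

(** The order condition makes the formula of [elemE] additive although [co] is defined only modulo
    [p ^ l b]. The unit condition makes it injective: the [b]-coordinate of a kernel element, times
    [co w b], is 0. *)
Lemma elem_exists b w :
  w *+ p ^ l b = 0 -> coprime p (co w b) -> exists s, elementary b w s.
Proof.
move=> w0 co_w.
have d0 : (w - e b) *+ p ^ l b = 0 by rewrite mulrnBl w0 e_ord subr0.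
have [| |s sA sE] := @zmod_aut_exists A (fun a => a + (w - e b) *+ co a b).
- move=> a a' /=; rewrite (mulrn_modn d0 (coD a a' b)) mulrnDr.
  by rewrite addrACA.
- move=> a a0; suff ab0 : co a b = 0 %[mod p ^ l b].
    by move: a0; rewrite (mulrn_modn d0 ab0) addr0.
  have : a + w *+ co a b = e b *+ co a b.
    by apply/eqP; rewrite -subr_eq0 -addrA -mulrnBl a0.
  move=> /(congr1 (co^~ b)) /(congr1 (modn^~ (p ^ l b)%N)) /=.
  rewrite coMn coD -modnDmr coMn modnDmr -[in RHS]modnMml co_e_eq modnMml mul1n.
  move/eqP; rewrite -[X in _ == X %[mod _]]addn0 eqn_modDl mod0n.
  rewrite -/(dvdn _ _) Gauss_dvdr ?coprimeXl //.
  by move=> /eqP->; rewrite ?mod0n.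
exists s; split=> // [|c cb]; rewrite sE.
  rewrite (mulrn_modn d0 (co_e_eq b)); exact: subrKC.
by rewrite (mulrn_modn d0 (co_e_neq cb)) addr0.
Qed.

Lemma coprime_eq_modn b m n :
  m = n %[mod p ^ l b] -> coprime p m = coprime p n.
Proof.
move=> mn; rewrite -(coprime_pexpl p m (l_gt0 b)) -(coprime_pexpl p n (l_gt0 b)).
by rewrite -coprime_modr mn coprime_modr.
Qed.

Lemma transvection_exists b v :
  v *+ p ^ l b = 0 -> co v b = 0 %[mod p ^ l b] -> exists s, elementary b (e b + v) s.
Proof.
move=> v_ord v0; apply: elem_exists; first by rewrite mulrnDl e_ord v_ord addr0.
rewrite (@coprime_eq_modn b _ 1) ?coprimen1 //.
by rewrite coD -modnDmr v0 modnDmr addn0 co_e_eq.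
Qed.

(** * Vanishing of homomorphisms when the gaps are small *)

Section Killed.

Variables (M : finZmodType) (N : nat) (F : {perm A} -> M).
Hypothesis p_odd : odd p.
Hypothesis M_exp : forall m : M, m *+ p ^ N = 0.
Hypothesis FM : {in Aut [set: A] &, forall s t, F (s * t)%g = F s + F t}.

Lemma coprime_torsion_free n (m : M) : coprime p n -> m *+ n = 0 -> m = 0.
Proof.
move=> pn mn; have [N0|N0] := posnP N.
  by rewrite -[m]mulr1n -(M_exp m) N0 expn0.
have pN : coprime n (p ^ N) by rewrite coprime_sym coprimeXl.
have pN0 : (0 < p ^ N)%N by rewrite expn_gt0 prime_gt0.
have [n0|n0] := posnP n.
  have: coprime p 0 by rewrite -n0.
  by rewrite /coprime gcdn0 => /eqP p1; move: p_pr; rewrite p1.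
have [km kn Ekm _] := egcdnP (p ^ N) n0.
rewrite (eqP pN) in Ekm.
have: m *+ (km * n) = m *+ (kn * p ^ N + 1) by rewrite Ekm.
by rewrite mulrnDr !(mulnC _ n) !(mulnC _ (p ^ N)%N) !mulrnA mn M_exp !mul0rn add0r.
Qed.

Lemma F1 : F 1%g = 0.
Proof. by apply: (@addIr _ (F 1%g)); rewrite -FM ?group1 // mulg1 add0r. Qed.

Lemma FX s n : s \in Aut [set: A] -> F (s ^+ n)%g = F s *+ n.
Proof.
move=> sA; elim: n => [|n IHn]; first exact: F1.
by rewrite expgS FM ?groupX // IHn mulrS.
Qed.

(* Conjugation by the automorphism negating [e b] inverts [s]. *)
Lemma transvection_killed b v s :
  elementary b (e b + v) s -> co v b = 0 %[mod p ^ l b] -> F s = 0.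
Proof.
move=> s_el v0; have [sA sb sc] := s_el.
have [||r r_el] := @elem_exists b (- e b).
- by rewrite mulNrn e_ord oppr0.
(* The [b]-coordinate of [- e b] is -1 modulo [p], hence prime to [p]. *)
- have: (e b - e b) = 0 by rewrite subrr.
  move/(congr1 (co^~ b))/(congr1 (modn^~ (p ^ l b)%N)).
  rewrite coD co0 -modnDml co_e_eq modnDml mod0n => /eqP; rewrite -/(dvdn _ _) add1n.
  move=> /(dvdn_trans (dvdn_exp (l_gt0 b) (dvdnn p))) pd.
  apply: coprime_dvdl pd _; exact: coprimeSn.
have [rA rb rc] := r_el.
have srs : (s * r * s = r)%g.
  apply: aut_eq; rewrite ?groupM // => c; rewrite !permM.
  have [->|cb] := eqVneq c b; last by rewrite sc // rc // sc.
  rewrite sb zmod_autD // rb (elem_fix r_el) // zmod_autD // (elem_fix s_el v0).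
  have /eqP := zmod_autD sA (e b) (- e b).
  rewrite subrr zmod_aut0 // eq_sym addrC addr_eq0 => /eqP->.
  by rewrite sb opprD addrNK.
apply: (@coprime_torsion_free 2); first by rewrite coprimen2.
apply: (@addIr _ (F r)); rewrite -[in RHS]srs !FM ?groupM // add0r.
by rewrite addrAC.
Qed.

Lemma elemX b u s n :
  elementary b (e b *+ u) s -> elementary b (e b *+ u ^ n) (s ^+ n)%g.
Proof.
case=> sA sb sc; elim: n => [|n [IHA IHb IHc]].
  by split=> [||c _]; rewrite ?group1 ?perm1.
split=> [||c cb]; rewrite ?groupX // expgSr permM; last by rewrite IHc ?sc.
by rewrite IHb zmod_autMn // sb -mulrnA expnS.
Qed.

Hypothesis l_gap : forall b, (1 < l b)%N -> exists c, l c = (l b).-1.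

(* With [U = 1 + p * h] and [V] its inverse, the (1 + x y)-identity           *)
(*   [1, p h; 0, 1] [1, 0; 1, 1]                                              *)
(*     = [1, 0; V, 1] [U, 0; 0, V] [1, p h V; 0, 1]                           *)
(* for the basis vectors [e b] and [e c], with [l c = (l b).-1], trades a     *)
(* dilation of [e b] for a dilation of [e c].                                 *)
Lemma dilation_killed b u s :
  elementary b (e b *+ u) s -> coprime p u -> F s = 0.
Proof.
have [n] := ubnP (l b); elim: n => // n IHn in b u s *; rewrite ltnS => lbn s_el pu.
have p_gt1 := prime_gt1 p_pr; have p_gt0 := prime_gt0 p_pr.
have [sA _ _] := s_el.
(* Passing to the power [p - 1] loses nothing in a [p]-group, and by Fermat it makes the factor of
   the dilation 1 modulo [p]. *)
apply: (@coprime_torsion_free p.-1).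
  by rewrite -{1}(prednK p_gt0) coprimeSn.
rewrite -FX //; move: (elemX p.-1 s_el); set t := (s ^+ _)%g; set U := (u ^ _)%N.
have pU : coprime p U by rewrite coprimeXr.
have U1 : (U %% p = 1)%N.
  by rewrite /U -totient_prime // Euler_exp_totient 1?coprime_sym // modn_small.
have UE : U = (1 + p * (U %/ p))%N by rewrite {1}(divn_eq U p) U1 addnC mulnC.
move: (U %/ p)%N UE => h UE t_el; have [tA tb tc] := t_el.
have [lb1|lb1] := leqP (l b) 1.
  have lb : l b = 1%N by apply/eqP; rewrite eqn_leq lb1 l_gt0.
  suff -> : t = 1%g by exact: F1.
  apply: aut_eq; rewrite ?group1 // => c; rewrite perm1.
  have [->|/tc //] := eqVneq c b.
  have ebp : e b *+ p = 0 by rewrite -(e_ord b) lb expn1.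
  by rewrite tb UE mulrnDr mulrnA ebp mul0rn addr0.
have [c lc] := l_gap lb1.
have lbS : l b = (l c).+1 by rewrite lc prednK // l_gt0.
have cb : c != b by apply: contra_eq_neq lbS => ->; rewrite neq_ltn ltnSn.
have bc : b != c by rewrite eq_sym.
pose V := (U ^ (totient (p ^ l b)).-1)%N.
have pV : coprime p V by rewrite coprimeXr.
have UV : (U * V = 1 %[mod p ^ l b])%N.
  rewrite -expnS prednK ?totient_gt0 ?expn_gt0 ?p_gt0 //.
  by rewrite Euler_exp_totient // coprime_sym coprimeXl.
have UVc : (U * V = 1 %[mod p ^ l c])%N.
  have dv : (p ^ l c %| p ^ l b)%N by rewrite dvdn_exp2l // lbS.
  by rewrite -(modn_dvdm _ dv) UV modn_dvdm.
have ec_ord : e c *+ p ^ l b = 0 by rewrite lbS expnSr mulrnA e_ord mul0rn.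
(* Here the gap of one is essential: a factor [p] is enough for a multiple of [e b] to be added to
   the image of [e c]. *)
have eb_ord m : e b *+ (p * m) *+ p ^ l c = 0.
  by rewrite -mulrnA mulnAC -expnS -lbS mulrnA e_ord mul0rn.
have co_eMn i j m : i != j -> co (e i *+ m) j = 0 %[mod p ^ l j].
  by move=> ij; rewrite coMn -modnMml co_e_neq // modnMml.
have [q1 q1_el] := transvection_exists (eb_ord h) (co_eMn _ _ _ bc).
have [q2 q2_el] := transvection_exists ec_ord (co_e_neq cb).
have [q3 q3_el] := transvection_exists (eb_ord (h * V)%N) (co_eMn _ _ _ bc).
have ecV_ord : e c *+ V *+ p ^ l b = 0 by rewrite mulrnAC ec_ord mul0rn.
have [q6 q6_el] := transvection_exists ecV_ord (co_eMn _ _ _ cb).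
have [q5 q5_el] : exists q5, elementary c (e c *+ V) q5.
  apply: elem_exists; first by rewrite mulrnAC e_ord mul0rn.
  rewrite (@coprime_eq_modn c _ V) //.
  by rewrite coMn -modnMml co_e_eq modnMml mul1n.
have Fq1 := transvection_killed q1_el (co_eMn _ _ _ bc).
have Fq2 := transvection_killed q2_el (co_e_neq cb).
have Fq3 := transvection_killed q3_el (co_eMn _ _ _ bc).
have Fq6 := transvection_killed q6_el (co_eMn _ _ _ cb).
have Fq5 : F q5 = 0.
  by apply: IHn q5_el pV; rewrite -ltnS -lbS.
have [q1A q1c q1E] := q1_el; have [q2A q2b q2E] := q2_el.
have [q3A q3c q3E] := q3_el; have [q5A q5c q5E] := q5_el.
have [q6A q6b q6E] := q6_el.
(* Only [t] and [q5] are dilations, so applying [F] leaves [F t = 0]. The left factor of a product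
   acts first. *)
have eq_q : (q2 * q1 = q3 * q5 * t * q6)%g.
  apply: aut_eq; rewrite ?groupM // => d; rewrite !permM.
  have [->|db] := eqVneq d b.
    rewrite q2b zmod_autD // q1c q1E // q3E // q5E // tb zmod_autMn // q6b.
    rewrite mulrnDl -mulrnA (mulnC V) (mulrn_modn (e_ord c) UVc) mulr1n.
    rewrite UE mulrnDr mulr1n; by rewrite -!addrA (addrC (e c)).
  have [->|dc] := eqVneq d c; last first.
    by rewrite q2E // q1E // q3E // q5E // tc // q6E.
  rewrite q2E // q1c q3c !(zmod_autD, zmod_autMn) // q5c q5E //.
  rewrite !zmod_autMn // tc // tb !zmod_autMn // q6E // q6b.
  rewrite -mulrnA mulrnDl addrCA addrC; congr (_ + _).
    rewrite addrC -mulrnA -mulrnDr -[LHS]mulr1n.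
    apply/mulrn_modn/esym; first exact: e_ord.
    have -> : (V * (U * (p * (h * V))) + V = U * V * (p * h * V) + V)%N.
      by rewrite !mulnA (mulnC V U).
    rewrite -modnDml -modnMml UVc modnMml mul1n modnDml -[RHS]UVc UE.
    by rewrite mulnDl mul1n addnC.
  apply/mulrn_modn/esym; first exact: e_ord.
  rewrite (_ : U * _ = U * V * (p * h))%N; last first.
    by rewrite !mulnA (mulnAC _ h V) (mulnAC _ p V).
  by rewrite -modnMml UV modnMml mul1n.
have := congr1 F eq_q.
by rewrite !FM ?groupM // Fq1 Fq2 Fq3 Fq5 Fq6 !(addr0, add0r).
Qed.

(** Writing [w = u e b + z], with [z] free of [e b], the automorphism is the transvection by [z]
    followed by the dilation by [u]. *)
Lemma elem_killed b w s : elementary b w s -> coprime p (co w b) -> F s = 0.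
Proof.
move=> s_el pw; pose u := co w b; pose z := w - e b *+ u.
have [sA sb sc] := s_el.
have eu : co (e b *+ u) b = u %[mod p ^ l b].
  by rewrite coMn -modnMml co_e_eq modnMml mul1n.
have z0 : co z b = 0 %[mod p ^ l b].
  apply/eqP; rewrite -(eqn_modDr (co (e b *+ u) b)) -coD subrK add0n.
  exact/eqP/esym.
have z_ord : z *+ p ^ l b = 0.
  by rewrite mulrnBl (elem_ord s_el) mulrnAC e_ord mul0rn subr0.
have [q q_el] := transvection_exists z_ord z0.
have [d d_el] : exists d, elementary b (e b *+ u) d.
  by apply: elem_exists; rewrite ?(coprime_eq_modn eu) // mulrnAC e_ord mul0rn.
have [qA qb qc] := q_el; have [dA db dc] := d_el.
have -> : s = (q * d)%g.
  apply: aut_eq; rewrite ?groupM // => c; rewrite permM.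
  have [->|cb] := eqVneq c b; last by rewrite qc // dc // sc.
  by rewrite qb zmod_autD // db (elem_fix d_el z0) subrKC sb.
by rewrite FM // (transvection_killed q_el z0) (dilation_killed d_el pw) addr0.
Qed.

(* Gaussian elimination, by decreasing order of the basis vectors. *)
Lemma aut_killed s : s \in Aut [set: A] -> F s = 0.
Proof.
(* [S] indexes the basis vectors already fixed; the induction is on the size of its complement. *)
move=> sA; suff killed (S : {set B}) t :
    (forall b c, b \in S -> c \notin S -> (l c <= l b)%N) ->
    t \in Aut [set: A] -> (forall b, b \in S -> t (e b) = e b) -> F t = 0.
  by apply: (killed set0) => // b; rewrite inE.
have [n] := ubnP #|~: S|; elim: n => // n IHn in S t *; rewrite ltnS => Sn S_top tA tS.
have [S0|[b0]] := set_0Vmem (~: S).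
  suff -> : t = 1%g by exact: F1.
  apply: aut_eq; rewrite ?group1 // => b; rewrite perm1 tS //.
  by have /setP/(_ b) := S0; rewrite !inE => /negbFE.
rewrite inE => b0S.
have [b bS b_max] : exists2 b, b \notin S & forall c, c \notin S -> (l c <= l b)%N.
  by case: (arg_maxnP (P := fun b => b \notin S) l b0S) => b; exists b.
(* A unit [b]-coordinate makes "replace [e b] by [r (e b)]" an automorphism,  *)
(* and dividing by it fixes one more basis vector.                            *)
have unit_case r : r \in Aut [set: A] -> (forall c, c \in S -> r (e c) = e c) ->
    coprime p (co (r (e b)) b) -> F r = 0.
  move=> rA rS rb.
  have [|q q_el] := elem_exists _ rb; first by rewrite -zmod_autMn // e_ord zmod_aut0.
  have [qA qb qc] := q_el.
  rewrite -[r](mulgKV q) FM ?groupM ?groupV // (elem_killed q_el rb) addr0.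
  apply: (IHn (b |: S)); rewrite ?groupM ?groupV //.
  - rewrite (leq_trans _ Sn) // proper_card // properE setCS subsetUr /=.
    by apply/subsetPn; exists b; rewrite !inE ?eqxx.
  - move=> c d; rewrite !inE negb_or => /orP[/eqP->|cS] /andP[_ dS].
      exact: b_max.
    exact: S_top.
  - move=> c; rewrite !inE permM => /predU1P[->|cS]; first by rewrite -qb permK.
    have cb : c != b by apply: contraNneq bS => <-.
    by rewrite rS // -{1}(qc c cb) permK.
have [pb|pb] := boolP (coprime p (co (t (e b)) b)); first exact: unit_case.
have [/existsP[c /and3P[cS /eqP lcb pc]]|/existsPn np] :=
    boolP [exists c, [&& c \notin S, l c == l b & coprime p (co (t (e b)) c)]]; last first.
  (* This case is impossible: [x *+ m] would lie in the span of the vectors indexed by [S], which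
     [t] fixes, so injectivity of [t] would put [e b *+ m] in that span too, yet its [b]-coordinate
     is nonzero. *)
  pose x := t (e b); pose m := (p ^ (l b).-1)%N.
  have pm : (m * p = p ^ l b)%N by rewrite -expnSr prednK.
  have x0 c : c \notin S -> (co x c * m = 0 %[mod p ^ l c])%N.
    move=> cS; apply/eqP; rewrite mod0n -/(dvdn _ _).
    have := b_max c cS; rewrite leq_eqVlt => /predU1P[lcb|lcb].
      have := np c; rewrite cS lcb eqxx /=.
      by rewrite prime_coprime // negbK -pm mulnC => /dvdn_mul->.
    apply: dvdn_mull; apply: dvdn_exp2l; by rewrite -ltnS prednK.
  have xm : x *+ m = \sum_(c in S) e c *+ (co x c * m).
    rewrite {1}[x]co_sum -sumrMnl (bigID (mem S)) /= [X in _ + X]big1 ?addr0.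
      by apply: eq_bigr => c _; rewrite mulrnA.
    by move=> c cS; rewrite -mulrnA (mulrn_modn (e_ord c) (x0 c cS)).
  have : e b *+ m = x *+ m.
    apply: (@perm_inj _ t); rewrite zmod_autMn // -/x xm zmod_aut_sum //.
    by apply: eq_bigr => c cS; rewrite zmod_autMn // tS.
  move=> /(congr1 (co^~ b))/(congr1 (modn^~ (p ^ l b)%N)).
  rewrite coMn -modnMml co_e_eq modnMml mul1n xm co_bigsum.
  rewrite -modn_summ big1 => [|c cS].
    move/eqP; rewrite mod0n -/(dvdn _ _) => /dvdn_leq.
    rewrite expn_gt0 prime_gt0 // leq_exp2l ?prime_gt1 //.
    by rewrite -ltnS prednK // ltnn => /(_ isT).
  have cb : c != b by apply: contraNneq bS => <-.
  by rewrite coMn -modnMml co_e_neq // modnMml mod0n.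
have cb : c != b by apply: contraNneq pb => cb; rewrite -{2}cb.
have bc : b != c by rewrite eq_sym.
have eb_ord : e b *+ p ^ l c = 0 by rewrite lcb e_ord.
(* Sending [e c] to [e c + e b] adds the unit [c]-coordinate to the non-unit [b]-coordinate, which
   becomes a unit. *)
have [q q_el] := transvection_exists eb_ord (co_e_neq bc).
have [qA qc qE] := q_el.
have : F (t * q)%g = 0.
  apply: unit_case => [|d dS|]; first by rewrite groupM.
    by rewrite permM tS // qE //; apply: contraNneq cS => <-.
  rewrite permM (elemE _ q_el) [e c + _]addrC addrK.
  rewrite (@coprime_eq_modn b _ (co (t (e b)) b + co (t (e b)) c)%N); last first.
    by rewrite coD -modnDmr coMn -modnMml co_e_eq modnMml mul1n modnDmr.
  move: pb pc; rewrite !prime_coprime // negbK => pb; by rewrite dvdn_addr.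
by rewrite FM // (transvection_killed q_el (co_e_neq bc)) addr0.
Qed.

End Killed.

(** * A nonzero homomorphism when some gap is at least 2 *)

Section Determinant.

Variable m : nat.
Hypothesis l_sep : forall b, (l b <= m)%N || (m.+2 <= l b)%N.

Let S := [set b | (m.+2 <= l b)%N].
Let p2_gt1 : (1 < p ^ 2)%N.
Proof. by rewrite (ltn_exp2l 0) ?prime_gt1. Qed.

Lemma Zp2_natr_eq x y : (x = y %[mod p ^ 2])%N -> x%:R = y%:R :> 'Z_(p ^ 2).
Proof. by apply: mulrn_modn; exact: pchar_Zp. Qed.

(* The action of [s] on p^m A / p^(m+2) A, which is free over Z/p^2 with     *)
(* basis the classes of the [e b *+ p ^ m], [b \in S].                        *)
Definition gap_mx (s : {perm A}) : 'M['Z_(p ^ 2)]_#|S| :=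
  \matrix_(i, j) (co (s (e (enum_val i))) (enum_val j))%:R.

Lemma natr_gap b x y : b \in S -> (x = y %[mod p ^ l b])%N -> x%:R = y%:R :> 'Z_(p ^ 2).
Proof.
rewrite inE => lb xy; apply: Zp2_natr_eq.
have dv : (p ^ 2 %| p ^ l b)%N by rewrite dvdn_exp2l // (leq_trans _ lb).
by rewrite -(modn_dvdm x dv) xy modn_dvdm.
Qed.

(** Vectors outside [S] do not contribute: [t (e c)] is then killed by [p ^ m], so its coordinate at
    an index of exponent at least [m.+2] is divisible by [p ^ 2]. *)
Lemma gap_mxM s t : s \in Aut [set: A] -> t \in Aut [set: A] ->
  gap_mx (s * t)%g = gap_mx s *m gap_mx t.
Proof.
move=> sA tA; apply/matrixP=> i j; rewrite !mxE permM aut_co //.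
set x := s _; set d := enum_val j; have dS : d \in S := enum_valP j.
rewrite (natr_gap dS (co_bigsum _ _ _ _)) natr_sum (bigID (mem S)) /=.
rewrite [X in _ + X]big1 => [|c cS].
  rewrite addr0 big_enum_val; apply: eq_bigr => c _; rewrite !mxE.
  by rewrite (natr_gap dS (coMn _ _ _)) natrM mulrC.
have lc : (l c <= m)%N by have := l_sep c; rewrite inE in cS; rewrite (negbTE cS) orbF.
have tc : t (e c) *+ p ^ m = 0.
  rewrite -zmod_autMn // -(subnKC lc) expnD mulrnA e_ord mul0rn; exact: zmod_aut0.
rewrite (natr_gap dS (coMn _ _ _)) natrM.
suff -> : (co (t (e c)) d)%:R = 0 :> 'Z_(p ^ 2) by rewrite mul0r.
have /eqP := coMn (t (e c)) (p ^ m) d.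
rewrite tc co0 mod0n eq_sym -/(dvdn _ _).
have ld : (m.+2 <= l d)%N by move: dS; rewrite inE.
move=> /(dvdn_trans (dvdn_exp2l p ld)).
rewrite -addn2 expnD mulnC dvdn_pmul2r ?expn_gt0 ?prime_gt0 // => /eqP pc.
by rewrite (@Zp2_natr_eq _ 0) // mod0n.
Qed.

Lemma gap_mx1 : gap_mx 1%g = 1%:M.
Proof.
apply/matrixP=> i j; rewrite !mxE perm1 (natr_gap (enum_valP j) (co_e _ _)).
by rewrite (inj_eq enum_val_inj).
Qed.

Definition gap_det (s : {perm A}) : nat := \det (gap_mx s).

Lemma gap_det_natr s : (gap_det s)%:R = \det (gap_mx s).
Proof. exact: natr_Zp. Qed.

Lemma gap_detM s t : s \in Aut [set: A] -> t \in Aut [set: A] ->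
  (gap_det (s * t)%g = gap_det s * gap_det t %[mod p ^ 2])%N.
Proof.
move=> sA tA; rewrite {1}/gap_det gap_mxM // det_mulmx -!gap_det_natr -natrM.
by rewrite val_Zp_nat // modn_mod.
Qed.

Lemma gap_det_coprime s : s \in Aut [set: A] -> coprime p (gap_det s).
Proof.
move=> sA; rewrite -(coprime_pexpl p _ (isT : 0 < 2)%N) -unitZpE // gap_det_natr.
apply/unitrPr; exists (\det (gap_mx s^-1)).
by rewrite -det_mulmx -gap_mxM ?groupV // mulgV gap_mx1 det1.
Qed.

Lemma gap_det_dilation b s : b \in S -> elementary b (e b *+ (1 + p)) s ->
  (gap_det s = 1 + p %[mod p ^ 2])%N.
Proof.
move=> bS [sA sb sc].
have -> : gap_det s = ((1 + p)%:R : 'Z_(p ^ 2)) :> nat.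
  rewrite /gap_det; congr (nat_of_ord _).
  have -> : gap_mx s =
      diag_mx (\row_j if enum_val j == b then (1 + p)%:R else 1).
    apply/matrixP=> i j; rewrite !mxE.
    have jS := enum_valP j; rewrite -(inj_eq enum_val_inj).
    have [ib|ib] := eqVneq (enum_val i) b; last first.
      rewrite sc // (natr_gap jS (co_e _ _)).
      by case: eqVneq => // <-; rewrite (negbTE ib).
    rewrite ib sb (natr_gap jS (coMn _ _ _)) natrM (natr_gap jS (co_e _ _)).
    by rewrite eq_sym; case: eqVneq; rewrite ?mul1r ?mul0r.
  rewrite det_diag (bigD1 (enum_rank_in bS b)) //= mxE enum_rankK_in // eqxx.
  rewrite big1 ?mulr1 // => j jb; rewrite mxE ifN //.
  by apply: contraNneq jb => jb; rewrite -{2}jb enum_valK_in.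
by rewrite val_Zp_nat // modn_mod.
Qed.

(** The homomorphism is the Fermat quotient of [gap_det] times an element [a] of order [p], so
    values modulo [p] suffice. The dilation of [e b] by [1 + p] goes to [a *+ p.-1], which is
    nonzero. *)
Lemma nontrivial_hom b : (m.+2 <= l b)%N ->
  exists2 f : {perm A} -> A,
    {in Aut [set: A] &, forall s t, f (s * t)%g = f s + f t}
    & exists2 s, s \in Aut [set: A] & f s != 0.
Proof.
move=> lb; have bS : b \in S by rewrite inE.
have lb0 := l_gt0 b; pose a := e b *+ p ^ (l b).-1.
have ap : a *+ p = 0 by rewrite -mulrnA -expnSr prednK.
exists (fun s => a *+ fermat_quotient p (gap_det s)) => [s t sA tA|].
  rewrite -mulrnDr; apply: (mulrn_modn ap).
  by apply: fermat_quotientM; rewrite ?gap_det_coprime // gap_detM.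
have [||s s_el] := @elem_exists b (e b *+ (1 + p)).
- by rewrite mulrnAC e_ord mul0rn.
- rewrite (@coprime_eq_modn b _ (1 + p)%N) ?add1n ?coprimenS //.
  by rewrite coMn -modnMml co_e_eq modnMml mul1n.
have [sA _ _] := s_el; exists s => //.
have fq := fermat_quotient_succ p_pr (gap_det_dilation bS s_el).
rewrite (mulrn_modn ap fq) -mulrnA.
apply/eqP => /(congr1 (co^~ b))/(congr1 (modn^~ (p ^ l b)%N)).
rewrite coMn -modnMml co_e_eq modnMml mul1n co0 mod0n => /eqP.
have E : (p ^ l b = p ^ (l b).-1 * p)%N by rewrite -expnSr prednK.
rewrite -/(dvdn _ _) {1}E dvdn_pmul2l ?expn_gt0 ?prime_gt0 //.
have p_gt1 := prime_gt1 p_pr.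
move=> /dvdn_leq; rewrite -subn1 subn_gt0 p_gt1 => /(_ isT).
by rewrite leqNgt ltn_subrL (ltnW p_gt1).
Qed.

End Determinant.

End Coordinates.

(** * First cohomology with trivial action as homomorphisms *)

Section FirstCohomology.

Variables (gT : finGroupType) (M : finZmodType).
Local Notation act := (trivial_gmodule gT M).

Lemma coboundary1E (f : cochain gT M 1) (g h : gT) :
  coboundary_map act f [tuple g; h] = f [tuple h] - f [tuple (g * h)%g] + f [tuple g].
Proof.
have face1E i y : tnth (face i [tuple g; h]) ord0 = y -> face i [tuple g; h] = [tuple y].
  by move=> Ey; apply: eq_from_tnth => j; rewrite [j]ord1 Ey.
have f0 : face 0 [tuple g; h] = [tuple h] by apply: face1E; rewrite tnth_mktuple.
have f1 : face 1 [tuple g; h] = [tuple (g * h)%g] by apply: face1E; rewrite tnth_mktuple.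
have f2 : face 2 [tuple g; h] = [tuple g] by apply: face1E; rewrite tnth_mktuple.
rewrite ffunE 2?big_nat_recr //= big_geq // add0r.
move: (@face gT 1) f0 f1 f2 => F -> -> ->.
by rewrite expr1 sqrrN expr1n mulrN1z mulr1z addrA.
Qed.

Lemma coboundary0E (f : cochain gT M 0) : coboundary_map act f = 0.
Proof.
apply/ffunP=> x; rewrite !ffunE big_nat1 expr1 mulrN1z /=.
by rewrite [face 0 x]tuple0 [face 1 x]tuple0 subrr.
Qed.

(** For the trivial action the 1-cocycle condition is additivity ([coboundary1E]), and all
    1-coboundaries vanish ([coboundary0E]). *)
Lemma H1_trivialP :
  cohomology act 1 = 1%g <->
  forall f : gT -> M, (forall g h, f (g * h)%g = f g + f h) -> forall g, f g = 0.
Proof.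
have cob1 : coboundaries act 1 = 1%g.
  apply/setP=> f; rewrite !inE; apply/imsetP/eqP => [[f' _ ->]|->].
    exact: coboundary0E.
  by exists 0; rewrite ?inE ?coboundary0E.
have nco : cocycles act 1 \subset ('N(coboundaries act 1))%g by rewrite cob1 norm1 subsetT.
have E : (cohomology act 1 == 1%g) = (cocycles act 1 \subset coboundaries act 1).
  by rewrite -quotient_sub1 // subG1.
split=> [H1 f fM g|homs].
  pose F : cochain gT M 1 := [ffun x => f (thead x)].
  have FZ : F \in cocycles act 1.
    rewrite inE; apply/eqP/ffunP=> -[[|a [|b [|? ?]]] sz] //.
    rewrite (_ : Tuple sz = [tuple a; b]); last exact: val_inj.
    by rewrite coboundary1E !ffunE !theadE fM opprD addrCA subrr addr0 addNr.
  have: cocycles act 1 \subset coboundaries act 1 by rewrite -E H1.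
  rewrite cob1 => /subsetP/(_ _ FZ); rewrite inE => /eqP F0.
  by have := congr1 (fun F : cochain _ _ _ => F [tuple g]) F0; rewrite !ffunE.
apply/eqP; rewrite E cob1; apply/subsetP=> f; rewrite !inE => /eqP f0.
apply/eqP/ffunP=> -[[|a [|? ?]] sz] //.
rewrite (_ : Tuple sz = [tuple a]) ?ffunE; last exact: val_inj.
apply: (homs (fun g => f [tuple g])) => g h.
have := congr1 (fun F : cochain _ _ _ => F [tuple g; h]) f0.
rewrite coboundary1E ffunE => /eqP.
by rewrite addrAC subr_eq0 eq_sym addrC => /eqP.
Qed.

End FirstCohomology.

Lemma aut_H1_trivialP (A : finZmodType) :
  cohomology (trivial_gmodule (automorphism_group A) A) 1 = 1%g <->
  forall f : {perm A} -> A,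
    {in Aut [set: A] &, forall s t, f (s * t)%g = f s + f t} ->
    forall s, s \in Aut [set: A] -> f s = 0.
Proof.
rewrite H1_trivialP; split=> homs f fM => [s sA|g].
  have := homs (fun g => f (sgval g)) _ (subg _ s); rewrite subgK //; apply=> g h.
  by rewrite fM ?subgP.
have := homs (fun s => f (subg _ s)) _ (sgval g) (subgP g).
by rewrite sgvalK; apply=> s t sA tA; rewrite subgM.
Qed.

(** * The standard basis of the abelian [p]-group *)

Section AbelianPGroup.

Variables (k p : nat) (lam rho : 'I_k -> nat).
Hypothesis p_pr : prime p.
Hypothesis lam_gt0 : forall i, (0 < lam i)%N.

Local Notation A := (abelian_pgroup p lam rho).
Local Notation B := {i : 'I_k & 'I_(rho i)}.

Definition pg_ord (b : B) : nat := lam (tag b).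

Definition pg_coord (a : A) (b : B) : nat := a (tag b) ord0 (tagged b).

(* Comparing the second indices as naturals avoids a cast along [tag b = j]. *)
Definition pg_vec (b : B) : A :=
  [ffun j => \row_q ((tag b == j) && (tagged b == q :> nat))%:R].

Let pl_gt1 i : (1 < p ^ lam i)%N.
Proof. by rewrite -(exp1n (lam i)) ltn_exp2r ?prime_gt1. Qed.

Lemma pg_entry_sum i j I (r : seq I) (P : pred I) (F : I -> A) :
  (\sum_(x <- r | P x) F x : A) i ord0 j = \sum_(x <- r | P x) F x i ord0 j.
Proof.
by apply: (big_morph (fun a : A => a i ord0 j)) => [a a'|]; rewrite !ffunE !mxE.
Qed.

Lemma pg_entryMn i j (a : A) n : (a *+ n : A) i ord0 j = a i ord0 j *+ n.
Proof.
elim: n => [|n IHn]; first by rewrite !mulr0n !ffunE !mxE.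
by rewrite !mulrS -IHn !ffunE !mxE.
Qed.

Lemma pg_coord_sum (a : A) : a = \sum_b pg_vec b *+ pg_coord a b.
Proof.
apply/ffunP=> i; apply/rowP=> j; rewrite pg_entry_sum.
rewrite (bigD1 (Tagged (fun i => 'I_(rho i)) j)) //= big1 => [|[i' j'] neq_b].
  by rewrite addr0 pg_entryMn ffunE mxE !eqxx natr_Zp.
rewrite pg_entryMn ffunE mxE /=; case: eqP => [ii'|]; last by rewrite mul0rn.
subst i'; rewrite (_ : (j' == j :> nat) = false) ?mul0rn //.
by apply: contraNF neq_b => /eqP/val_inj ->.
Qed.

Lemma pg_coordD (a a' : A) b :
  (pg_coord (a + a')%R b = pg_coord a b + pg_coord a' b %[mod p ^ pg_ord b])%N.
Proof.
rewrite /pg_coord !ffunE !mxE.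
rewrite -{1}[a _ _ _]natr_Zp -{1}[a' _ _ _]natr_Zp -natrD val_Zp_nat //.
by rewrite modn_mod.
Qed.

Lemma pg_coord_vec b c : (pg_coord (pg_vec b) c = (b == c) %[mod p ^ pg_ord c])%N.
Proof.
rewrite /pg_coord !ffunE !mxE val_Zp_nat // modn_mod.
suff -> : (tag b == tag c) && (tagged b == tagged c :> nat) = (b == c) by [].
apply/andP/eqP => [|->]; last by rewrite !eqxx.
case: b c => [i j] [i' j'] /= [/eqP ii'].
by subst i'; move=> /eqP/val_inj->.
Qed.

Lemma pg_vec_ord b : pg_vec b *+ p ^ pg_ord b = 0.
Proof.
apply/ffunP=> i; apply/rowP=> j; rewrite pg_entryMn !ffunE !mxE.
case: eqVneq => [tbi|]; last by rewrite mul0rn.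
by case: (_ == _); rewrite ?mul0rn // /pg_ord tbi pchar_Zp.
Qed.

Lemma pg_exponent (a : A) : a *+ p ^ (\max_i lam i) = 0.
Proof.
apply/ffunP=> i; apply/rowP=> j; rewrite pg_entryMn !ffunE !mxE.
rewrite -(subnKC (leq_bigmax (F := lam) i)) expnD mulrnA -[X in X *+ _ *+ _]mulr1.
by rewrite -mulrnAr (pchar_Zp (pl_gt1 i)) mulr0 mul0rn.
Qed.

End AbelianPGroup.

Theorem theorem5p9 (k : nat) (lam rho : 'I_k -> nat) (p : nat)
    (k_gt0 : (0 < k)%N)
    (lam_decr : forall i j : 'I_k, (i < j)%N -> (lam j < lam i)%N)
    (lam_gt0 : forall i : 'I_k, (0 < lam i)%N)
    (rho_gt0 : forall i : 'I_k, (0 < rho i)%N)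
    (p_prime : prime p) (p_odd : odd p) :
  let A := abelian_pgroup p lam rho in
  let G := automorphism_group A in
  cohomology (trivial_gmodule G A) 1 = 1%g
  <-> forall i : 'I_k, (lam i - next_part lam i <= 1)%N.
Proof.
move=> A G; rewrite aut_H1_trivialP.
pose B := {i : 'I_k & 'I_(rho i)}.
pose idx i : B := Tagged (fun i => 'I_(rho i)) (Ordinal (rho_gt0 i)).
have l_gt0 (b : B) : (0 < pg_ord lam b)%N := lam_gt0 _.
have co_sum := @pg_coord_sum k p lam rho.
have coD := pg_coordD p_prime lam_gt0 (rho := rho).
have co_e := pg_coord_vec p_prime lam_gt0 (rho := rho).
have e_ord := pg_vec_ord p_prime lam_gt0 (rho := rho).
split=> [homs i|gaps f fM s sA].
  rewrite leqNgt; apply/negP; rewrite ltn_subRL addn1 => gap.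
  (* With [m] the part following [lam i], later parts are at most [m], while [lam i] and earlier
     parts are at least [m.+2]. *)
  have l_sep (b : B) :
      (pg_ord lam b <= next_part lam i)%N || ((next_part lam i).+2 <= pg_ord lam b)%N.
    case: b => j r; rewrite /pg_ord /=; have [ij|ji] := ltnP i j.
      rewrite /next_part; case: insubP => [j' _ Ej'|]; last first.
        by rewrite -leqNgt => /leq_trans/(_ ij); rewrite leqNgt ltn_ord.
      apply/orP; left; move: ij; rewrite -Ej' leq_eqVlt.
      by move=> /predU1P[/val_inj->|/lam_decr/ltnW].
    apply/orP; right; apply: leq_trans gap _.
    by move: ji; rewrite leq_eqVlt => /predU1P[/val_inj->|/lam_decr/ltnW].
  have [f fM [s sA]] :=
    nontrivial_hom p_prime l_gt0 co_sum coD co_e e_ord l_sep (b := idx i) gap.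
  by rewrite homs ?eqxx.
apply: (aut_killed p_prime l_gt0 co_sum coD co_e e_ord p_odd (pg_exponent _ _)) sA => //.
(* A last part above 1 would violate the bound, its successor being 0; otherwise strict decrease
   makes the next part exactly [(lam i).-1]. *)
case=> i r; rewrite /pg_ord /= => lam_gt1; have := gaps i.
rewrite /next_part; case: insubP => [j _ Ej|_]; last by rewrite subn0 leqNgt lam_gt1.
have lam_ji : (lam j < lam i)%N by apply: lam_decr; rewrite Ej.
rewrite leq_subLR addn1 => lam_ij; exists (idx j) => /=.
by apply/eqP; rewrite -eqSS prednK // eqn_leq lam_ij lam_ji.
Qed.
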